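(* Let $(\mathcal{E},\mathcal{D}(\mathcal{E}))$ be a regular, irreducible, transient Dirichlet form on $L^2(E;m)$ such that $1_K\in\mathcal{L}$ for every compact set $K\subset E$, and let $\mu$ be a positive smooth Radon measure on $E$. If $\lambda(\mu)>1$, where $$\lambda(\mu)=\inf\Big\{\mathcal{E}(u)\ :\ u\in\mathcal{D}(\mathcal{E})\cap C_0(E),\ \int_E u^2\,d\mu=1\Big\},$$ then $(\mathcal{E}^\mu,\mathcal{D}(\mathcal{E}^\mu))$ is subcritical.
   Context: $E$ is a locally compact separable metric space, $m$ a positive Radon measure on $E$ with full topological support, $C_0(E)$ the continuous functions with compact support. For a symmetric form $a$ write $a(u)=a(u,u)$. Irreducible: if a measurable $A\subset E$ satisfies $T_t(1_Af)=1_AT_tf$ $m$-a.e. for all $f\in L^2(E;m)$, $t>0$ ($T_t$ the semigroup of $\mathcal{E}$), then $m(A)=0$ or $m(A^c)=0$. Transient: there is a bounded $g\in L^1(E;m)$, $g>0$ $m$-a.e., with $\int_E|u|g\,dm\le\sqrt{\mathcal{E}(u)}$ for all $u\in\mathcal{D}(\mathcal{E})$. The extended Dirichlet space $\mathcal{D}_e(\mathcal{E})$ is the set of $m$-measurable $u$, $|u|<\infty$ $m$-a.e., for which there is an $\mathcal{E}$-Cauchy sequence $u_n\in\mathcal{D}(\mathcal{E})$ with $u_n\to u$ $m$-a.e.; $\mathcal{E}(u)=\lim\mathcal{E}(u_n)$. A positive Borel measure is smooth if it charges no set of zero capacity and there are increasing closed sets $F_n$ with $\mu(F_n)<\infty$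 and $\lim_n\mathrm{Cap}(K\setminus F_n)=0$ for every compact $K$ (Cap is the 1-capacity of $\mathcal{E}$). $\mathcal{L}$ is the set of functions $f$ for which there is a constant $C$ with $\big|\int_E|f|\varphi\,dm\big|\le C\,\mathcal{E}(\varphi)^{1/2}$ for all $\varphi\in\mathcal{D}_e(\mathcal{E})$. $\mathcal{E}^\mu(u,v)=\mathcal{E}(u,v)-\int_Euv\,d\mu$ on $\mathcal{D}(\mathcal{E})\cap C_0(E)$; when $\lambda(\mu)>1$ this form is positive semi-definite and closable in $L^2(E;m)$ and $(\mathcal{E}^\mu,\mathcal{D}(\mathcal{E}^\mu))$ denotes its closure. The extended Schrödinger space $\mathcal{D}_e(\mathcal{E}^\mu)$ is defined from $(\mathcal{E}^\mu,\mathcal{D}(\mathcal{E}^\mu))$ in the same way as $\mathcal{D}_e(\mathcal{E})$ from $(\mathcal{E},\mathcal{D}(\mathcal{E}))$, with $\mathcal{E}^\mu(u)=\lim\mathcal{E}^\mu(u_n)$ for an approximating sequence. Subcritical: there is a bounded $g\in L^1(E;m)$, $g>0$ $m$-a.e., with $\int_E|u|g\,dm\le\sqrt{\mathcal{E}^\mu(u)}$ for all $u\in\mathcal{D}_e(\mathcal{E}^\mu)$. *)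

(* Defs.v *)
From HB Require Import structures.
From mathcomp Require Import all_boot all_order all_algebra.
From mathcomp Require Import all_classical all_reals all_analysis.
From mathcomp Require Import measurable_realfun.

Set Implicit Arguments.
Unset Strict Implicit.
Unset Printing Implicit Defensive.

Import Order.TTheory GRing.Theory Num.Theory.
Import numFieldNormedType.Exports.

Local Open Scope classical_set_scope.
Local Open Scope ring_scope.

(* The base point is there because a measurableType must be pointed. *)
#[short(type="pmetricType")]
HB.structure Definition PointedMetric (R : numDomainType) :=
  {T of Pointed T & Metric R T}.

Notation borel E := (g_sigma_algebraType (@open E)).

Section Space.
Context {R : realType} {E : pmetricType R}.

Definition separable_space := exists2 D : set E, countable D & dense D.

Definition radon (m : {measure set (borel E) -> \bar R}) :=
  forall K : set E, compact K -> (m K < +oo)%E.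

Definition full_support (m : {measure set (borel E) -> \bar R}) :=
  forall U : set E, open U -> U !=set0 -> (0 < m U)%E.

Definition C0 : set (borel E -> R) :=
  [set u | continuous (u : E -> R) /\
           compact (closure [set x : E | u x != 0])].

End Space.

(* Elements of L^2 are represented by Borel functions; [sf_dom_ae] and
   [sf_val_ae] below make forms independent of the representatives. *)
Record form_on (T R : Type) := FormOn {
  form_dom : set (T -> R);
  form_val :> (T -> R) -> (T -> R) -> R
}.

Section Forms.
Context {R : realType} {E : pmetricType R}.
Variable m : {measure set (borel E) -> \bar R}.
Local Notation fct := (borel E -> R).
Local Notation form := (form_on (borel E) R).
Implicit Types (a : form) (u v w f g h : fct).

Definition L2 : set fct := [set u | u \in Lfun m 2%:E].

Definition normL2 u : \bar R := 'N[m]_(2%:E)[EFin \o u].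
#[local] Arguments normL2 _%_ring_scope.

Definition inner u v : R := \int[m]_x (u x * v x).

Definition E1 a u v : R := a u v + inner u v.

Record symmetric_form a : Prop := {
  sf_L2 : form_dom a `<=` L2;
  sf_dom0 : form_dom a (cst 0);
  sf_domD : forall u v,
    form_dom a u -> form_dom a v -> form_dom a (u \+ v);
  sf_domZ : forall k u, form_dom a u -> form_dom a (k \*o u);
  sf_dense : forall f (e : \bar R), L2 f -> (0 < e)%E ->
    exists2 u, form_dom a u & (normL2 (f \- u) < e)%E;
  sf_dom_ae : forall u v,
    form_dom a u -> L2 v -> u = v %[ae m] -> form_dom a v;
  sf_val_ae : forall u v w, form_dom a u -> form_dom a v -> form_dom a w ->
    u = v %[ae m] -> a u w = a v w;
  sf_sym : forall u v, form_dom a u -> form_dom a v -> a u v = a v u;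
  sf_linear : forall k u v w,
    form_dom a u -> form_dom a v -> form_dom a w ->
    a ((k \*o u) \+ v) w = k * a u w + a v w;
  sf_ge0 : forall u, form_dom a u -> 0 <= a u u
}.

Definition form_cauchy a (u_ : nat -> fct) :=
  forall e : R, 0 < e -> exists N, forall i j, (N <= i)%N -> (N <= j)%N ->
    a (u_ i \- u_ j) (u_ i \- u_ j) < e.

Definition closed_form a :=
  forall u_ : nat -> fct, (forall n, form_dom a (u_ n)) ->
    (forall e : R, 0 < e -> exists N, forall i j, (N <= i)%N -> (N <= j)%N ->
       E1 a (u_ i \- u_ j) (u_ i \- u_ j) < e) ->
    exists2 u, form_dom a u &
      E1 a (u_ n \- u) (u_ n \- u) @[n --> \oo] --> 0.

Definition markovian a :=
  forall u, form_dom a u ->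
    let v : fct := fun x => Num.min (Num.max (u x) 0) 1 in
    form_dom a v /\ a v v <= a u u.

Definition dirichlet_form a :=
  [/\ symmetric_form a, closed_form a & markovian a].

Definition regular_form a :=
  (forall u (e : R), form_dom a u -> 0 < e ->
    exists2 v, (form_dom a `&` C0) v & E1 a (u \- v) (u \- v) < e) /\
  (forall f (e : R), C0 f -> 0 < e ->
    exists2 v, (form_dom a `&` C0) v & forall x, `|f x - v x| < e).

Record l2_semigroup (T : R -> fct -> fct) : Prop := {
  sg_L2 : forall t u, 0 < t -> L2 u -> L2 (T t u);
  sg_linear : forall t k u v, 0 < t -> L2 u -> L2 v ->
    T t ((k \*o u) \+ v) = (k \*o T t u) \+ T t v %[ae m];
  sg_sym : forall t u v, 0 < t -> L2 u -> L2 v ->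
    inner (T t u) v = inner u (T t v);
  sg_contraction : forall t u, 0 < t -> L2 u ->
    (normL2 (T t u) <= normL2 u)%E;
  sg_comp : forall s t u, 0 < s -> 0 < t -> L2 u ->
    T (s + t) u = T s (T t u) %[ae m];
  sg_continuous : forall u, L2 u ->
    normL2 (T t u \- u) @[t --> (0 : R)^'+] --> 0%E
}.

(* [h] is the value at [u] of the infinitesimal generator of [T] *)
Definition sg_generator (T : R -> fct -> fct) u h :=
  [/\ L2 u, L2 h &
      normL2 ((t^-1 \*o (T t u \- u)) \- h) @[t --> (0 : R)^'+] --> 0%E].

(* [h = A u] where [A] is the self-adjoint operator with
   [a u v = (- A u, v)] *)
Definition form_operator a u h :=
  [/\ form_dom a u, L2 h &
      forall v, form_dom a v -> a u v = - inner h v].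

Definition semigroup_of a (T : R -> fct -> fct) :=
  l2_semigroup T /\ forall u h, sg_generator T u h <-> form_operator a u h.

(* The semigroup of a closed symmetric form is unique up to m-a.e. equality *)
Definition irreducible_form a :=
  forall T, semigroup_of a T ->
  forall A : set (borel E), measurable A ->
    (forall f (t : R), L2 f -> 0 < t ->
       T t (\1_A \* f) = \1_A \* T t f %[ae m]) ->
    m A = 0%E \/ m (~` A) = 0%E.

Definition reference_function g :=
  [/\ bounded_fun g, g \in Lfun m 1%E & {ae m, forall x, 0 < g x}].

Definition transient a :=
  exists2 g, reference_function g & forall u, form_dom a u ->
    (\int[m]_x (`|u x| * g x)%:E <= (Num.sqrt (a u u))%:E)%E.

Definition ext_approx a (u : borel E -> \bar R) (u_ : nat -> fct) :=
  [/\ forall n, form_dom a (u_ n), form_cauchy a u_ &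
      {ae m, forall x, (u_ n x)%:E @[n --> \oo] --> u x}].

Definition ext_dom a : set (borel E -> \bar R) :=
  [set u : borel E -> \bar R |
    [/\ measurable_fun setT u, {ae m, forall x, u x \is a fin_num} &
        exists u_ : nat -> fct, ext_approx a u u_]].

(* The limit of [a (u_ n) (u_ n)] along an approximating sequence of [u] *)
Definition ext_energy a (u : borel E -> \bar R) : R :=
  xget 0 [set l | exists2 u_ : nat -> fct, ext_approx a u u_ &
                    a (u_ n) (u_ n) @[n --> \oo] --> l].

Definition subcritical a :=
  exists2 g, reference_function g &
    forall u : borel E -> \bar R, ext_dom a u ->
    (\int[m]_x (`|u x| * (g x)%:E) <= (Num.sqrt (ext_energy a u))%:E)%E.

Definition cap_open a (O : set E) : \bar R :=
  ereal_inf [set (E1 a u u)%:E | u in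
    [set u | form_dom a u /\ {ae m, forall x, O x -> 1 <= u x}]].

Definition cap a (A : set E) : \bar R :=
  ereal_inf [set cap_open a O | O in [set O | open O /\ A `<=` O]].

Definition smooth a (mu : {measure set (borel E) -> \bar R}) :=
  (forall A : set (borel E), measurable A -> cap a A = 0%E -> mu A = 0%E) /\
  exists F : nat -> set E,
    [/\ forall n, closed (F n), forall n, F n `<=` F n.+1,
        forall n, (mu (F n) < +oo)%E &
        forall K : set E, compact K ->
          cap a (K `\` F n) @[n --> \oo] --> 0%E].

(* Since [+oo - oo = -oo] in [\bar R], the inequality forces the integral to
   exist and to be finite. *)
Definition class_L a : set fct :=
  [set f : fct | measurable_fun setT f /\
    exists C : R, forall phi, ext_dom a phi ->
    (`|\int[m]_x (`|f x|%:E * phi x)|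
       <= (C * Num.sqrt (ext_energy a phi))%:E)%E].

Definition schrodinger_form a (mu : {measure set (borel E) -> \bar R}) : form :=
  FormOn (form_dom a `&` C0)
         (fun u v => a u v - \int[mu]_x (u x * v x)).

Definition closure_approx a u (u_ : nat -> fct) :=
  [/\ forall n, form_dom a (u_ n), form_cauchy a u_ &
      normL2 (u_ n \- u) @[n --> \oo] --> 0%E].

(* The closure of a closable nonnegative form *)
Definition form_closure a : form :=
  FormOn [set u | L2 u /\ exists u_ : nat -> fct, closure_approx a u u_]
         (fun u v => xget 0 [set l | exists u_ v_ : nat -> fct,
            [/\ closure_approx a u u_, closure_approx a v v_ &
                a (u_ n) (v_ n) @[n --> \oo] --> l]]).

Definition lambda a (mu : {measure set (borel E) -> \bar R}) : \bar R :=
  ereal_inf [set (a u u)%:E | u in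
    [set u | (form_dom a `&` C0) u /\
             (\int[mu]_x (u x ^+ 2)%:E = 1)%E]].

End Forms.

(* Main.v *)
(* If 1 < k <= lambda(mu), then k int u^2 dmu <= E(u) on D(E) n C_0, so
   (1 - 1/k) E(u) <= E^mu(u) <= E(u) there.  Hence E^mu-Cauchy sequences are
   E-Cauchy: as E is closed, E^mu is closable, its closure has domain inside
   D(E), and (1 - 1/k) E <= E^mu persists on the closure.  If g is a reference
   function for the transience of E, then sqrt(1 - 1/k) g works for E^mu on
   D(E^mu), and Fatou's lemma carries the bound over to D_e(E^mu). *)

Require Import Defs.
From HB Require Import structures.
From mathcomp Require Import all_boot all_order all_algebra.
From mathcomp Require Import all_classical all_reals all_analysis.
From mathcomp Require Import measurable_realfun.
From mathcomp Require Import ring lra.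

Import Order.TTheory GRing.Theory Num.Theory.
Import numFieldNormedType.Exports.
Local Open Scope classical_set_scope.
Local Open Scope ring_scope.

Set Implicit Arguments.
Unset Strict Implicit.

(** * Limits of real sequences and square roots *)

Lemma sqr_sqrt_cvg {R : realType} (x_ : nat -> R) (l : R) :
  (forall n, 0 <= x_ n) ->
  Num.sqrt (x_ n) @[n --> \oo] --> l -> x_ n @[n --> \oo] --> l ^+ 2.
Proof.
move=> x0 xl; under eq_fun do rewrite -(sqr_sqrtr (x0 _)) expr2.
by rewrite expr2; exact: cvgM.
Qed.

Lemma sqrt_cvg {R : realType} (x_ : nat -> R) (l : R) :
  x_ n @[n --> \oo] --> l -> Num.sqrt (x_ n) @[n --> \oo] --> Num.sqrt l.
Proof. by move=> xl; apply: continuous_cvg => //; exact: sqrt_continuous. Qed.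

Lemma le_norm_cvg {R : realType} (x_ y_ : nat -> R) (l : R) :
  (forall n, `|x_ n - l| <= y_ n) ->
  y_ n @[n --> \oo] --> 0 -> x_ n @[n --> \oo] --> l.
Proof.
move=> xy y0; apply: cvg_zero; apply: norm_cvg0.
apply: (@squeeze_cvgr _ _ _ _ (cst 0) y_) => //; last exact: cvg_cst.
by apply: nearW => n; rewrite /= normr_ge0 xy.
Qed.

(** * Positive semi-definite forms and their seminorms *)

Lemma subr_funE {T : Type} {R : realType} (u v : T -> R) :
  u \- v = ((-1) \*o v) \+ u.
Proof. by apply/funext => x /=; ring. Qed.

(** The purely algebraic part of a form, free of any reference measure, so that it covers alike [a],
    the inner product on [L2] and the Schrödinger form on its core. *)
Record semi_inner {R : realType} {E : pmetricType R}
    (q : form_on (borel E) R) : Prop := {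
  si_domD : forall u v, form_dom q u -> form_dom q v -> form_dom q (u \+ v);
  si_domZ : forall k u, form_dom q u -> form_dom q (k \*o u);
  si_sym : forall u v, form_dom q u -> form_dom q v -> q u v = q v u;
  si_linear : forall k u v w, form_dom q u -> form_dom q v -> form_dom q w ->
    q ((k \*o u) \+ v) w = k * q u w + q v w;
  si_ge0 : forall u, form_dom q u -> 0 <= q u u
}.

Section SemiInner.
Context {R : realType} {E : pmetricType R} (q : form_on (borel E) R).
Hypothesis qP : semi_inner q.
Local Notation D := (form_dom q).

Lemma si_domB u v : D u -> D v -> D (u \- v).
Proof.
by move=> Du Dv; rewrite subr_funE; apply: si_domD => //; exact: si_domZ.
Qed.

Lemma si_linear_sqr k u v : D u -> D v ->
  q ((k \*o u) \+ v) ((k \*o u) \+ v) =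
  k ^+ 2 * q u u + 2 * k * q u v + q v v.
Proof.
move=> Du Dv; have Dw : D ((k \*o u) \+ v).
  by apply: si_domD => //; exact: si_domZ.
rewrite si_linear// [q u _]si_sym// [q v _]si_sym// !si_linear//.
by rewrite [q v u]si_sym//; ring.
Qed.

Lemma si_scale k u : D u -> q (k \*o u) (k \*o u) = k ^+ 2 * q u u.
Proof.
(* Splitting off one copy of [u] gives the shape in which linearity is stated, without a zero
   function. *)
move=> Du; have -> : k \*o u = ((k - 1) \*o u) \+ u.
  by apply/funext => x /=; ring.
by rewrite si_linear_sqr//; ring.
Qed.

Lemma si_subE u v : D u -> D v ->
  q (u \- v) (u \- v) = q u u - 2 * q u v + q v v.
Proof.
by move=> Du Dv; rewrite subr_funE si_linear_sqr// [q v u]si_sym//; ring.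
Qed.

Lemma si_subC u v : D u -> D v -> q (u \- v) (u \- v) = q (v \- u) (v \- u).
Proof. by move=> Du Dv; rewrite !si_subE// [q v u]si_sym//; ring. Qed.

Lemma si_sub_linear u v w : D u -> D v -> D w -> q (u \- v) w = q u w - q v w.
Proof. by move=> Du Dv Dw; rewrite subr_funE si_linear//; ring. Qed.

Lemma si_cauchy_schwarz u v : D u -> D v ->
  `|q u v| <= Num.sqrt (q u u) * Num.sqrt (q v v).
Proof.
move=> Du Dv; rewrite -sqrtrM ?si_ge0// -sqrtr_sqr ler_sqrt; last first.
  by rewrite mulr_ge0// si_ge0.
have H k : 0 <= k ^+ 2 * q u u + 2 * k * q u v + q v v.
  rewrite -si_linear_sqr//; apply: si_ge0 => //.
  by apply: si_domD => //; exact: si_domZ.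
have [A0|A0] := eqVneq (q u u) 0.
  rewrite A0 mul0r; have [->|B0] := eqVneq (q u v) 0; first by rewrite expr0n.
  (* With [q u u = 0] the polynomial in [H] is affine with nonzero slope; at this point it takes the
     value -1. *)
  have := H (- (q v v + 1) / (2 * q u v)); rewrite A0 mulr0 add0r.
  suff -> : 2 * (- (q v v + 1) / (2 * q u v)) * q u v = - (q v v + 1) by lra.
  by field.
have {}A0 : 0 < q u u by rewrite lt_neqAle eq_sym A0 si_ge0.
(* The minimiser of the quadratic polynomial in [H]. *)
have := H (- q u v / q u u).
have -> : (- q u v / q u u) ^+ 2 * q u u + 2 * (- q u v / q u u) * q u v + q v v
   = (q u u * q v v - q u v ^+ 2) / q u u by field; rewrite gt_eqF.
by rewrite pmulr_lge0 ?invr_gt0// subr_ge0.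
Qed.

Lemma si_triangle u v : D u -> D v ->
  Num.sqrt (q u u) <= Num.sqrt (q v v) + Num.sqrt (q (u \- v) (u \- v)).
Proof.
move=> Du Dv; have Dw := si_domB Du Dv.
have nuv : q u u = q (u \- v) (u \- v) + 2 * q (u \- v) v + q v v.
  by rewrite si_subE// si_sub_linear//; ring.
rewrite -[leRHS]ger0_norm ?addr_ge0 ?sqrtr_ge0// -sqrtr_sqr ler_wsqrtr//.
rewrite sqrrD !sqr_sqrtr ?si_ge0// nuv.
have := le_trans (ler_norm _) (si_cauchy_schwarz Dw Dv); nra.
Qed.

Lemma si_lipschitz u v : D u -> D v ->
  `|Num.sqrt (q u u) - Num.sqrt (q v v)| <= Num.sqrt (q (u \- v) (u \- v)).
Proof.
move=> Du Dv; have := si_triangle Du Dv; have := si_triangle Dv Du.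
by rewrite [q (v \- u) _]si_subC// ler_norml => ? ?; apply/andP; split; lra.
Qed.

Lemma si_sub_le u v : D u -> D v ->
  q (u \- v) (u \- v) <= 2 * q u u + 2 * q v v.
Proof.
move=> Du Dv; have := si_ge0 qP (si_domD qP Du Dv).
have -> : u \+ v = (1 \*o u) \+ v by apply/funext => x /=; rewrite mul1r.
by rewrite si_linear_sqr// si_subE//; lra.
Qed.

Lemma si_cvg u_ v_ (l : R) : (forall n, D (u_ n)) -> (forall n, D (v_ n)) ->
  q (v_ n \- u_ n) (v_ n \- u_ n) @[n --> \oo] --> 0 ->
  q (u_ n) (u_ n) @[n --> \oo] --> l -> q (v_ n) (v_ n) @[n --> \oo] --> l.
Proof.
move=> Du_ Dv_ /sqrt_cvg; rewrite sqrtr0 => d0 ul.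
have l0 : 0 <= l.
  by apply: (cvgr_to_ge ul); apply: nearW => n; exact: si_ge0.
rewrite -(sqr_sqrtr l0); apply: sqr_sqrt_cvg => [n|]; first exact: si_ge0.
apply: (cvg_sub0 _ (sqrt_cvg ul)); apply: le_norm_cvg d0 => n /=.
by rewrite subr0; exact: si_lipschitz.
Qed.

(** The error is [q (u_ n) (v_ n \- u_ n)], which Cauchy-Schwarz bounds by a convergent factor times
    a null one. This serves values of the closure taken along two different sequences. *)
Lemma si_cross_cvg u_ v_ (l : R) :
  (forall n, D (u_ n)) -> (forall n, D (v_ n)) ->
  q (v_ n \- u_ n) (v_ n \- u_ n) @[n --> \oo] --> 0 ->
  q (u_ n) (u_ n) @[n --> \oo] --> l -> q (u_ n) (v_ n) @[n --> \oo] --> l.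
Proof.
move=> Du_ Dv_ /sqrt_cvg; rewrite sqrtr0 => d0 ul.
apply: (cvg_sub0 _ ul).
apply: (@le_norm_cvg _ _ (fun n => Num.sqrt (q (u_ n) (u_ n)) *
    Num.sqrt (q (v_ n \- u_ n) (v_ n \- u_ n)))); last first.
  by rewrite -(mulr0 (Num.sqrt l)); apply: cvgM => //; exact: sqrt_cvg.
move=> n /=; have Dd := si_domB (Dv_ n) (Du_ n).
by rewrite subr0 si_sym// -si_sub_linear// si_sym//; exact: si_cauchy_schwarz.
Qed.

Lemma si_sub_cvg0 u_ v_ : (forall n, D (u_ n)) -> (forall n, D (v_ n)) ->
  q (u_ n) (u_ n) @[n --> \oo] --> 0 -> q (v_ n) (v_ n) @[n --> \oo] --> 0 ->
  q (u_ n \- v_ n) (u_ n \- v_ n) @[n --> \oo] --> 0.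
Proof.
move=> Du_ Dv_ u0 v0.
apply: (@le_norm_cvg _ _ (fun n => 2 * q (u_ n) (u_ n) + 2 * q (v_ n) (v_ n))).
  move=> n; rewrite subr0 ger0_norm; last by apply/si_ge0/si_domB.
  exact: si_sub_le.
rewrite [X in _ --> X](_ : _ = 2 * 0 + 2 * 0); last by rewrite mulr0 addr0.
by apply: cvgD; apply: cvgM => //; exact: cvg_cst.
Qed.

End SemiInner.

(** The Lipschitz bound makes the square roots of the energies a Cauchy sequence of reals. Assuming
    just the two inequalities lets the lemma apply to the closure of the Schrödinger form as well as
    to the form itself. *)
Lemma lipschitz_cauchy_cvg {R : realType} {E : pmetricType R}
    (q : form_on (borel E) R) (u_ : nat -> borel E -> R) :
  (forall u, form_dom q u -> 0 <= q u u) ->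
  (forall u v, form_dom q u -> form_dom q v ->
    `|Num.sqrt (q u u) - Num.sqrt (q v v)| <= Num.sqrt (q (u \- v) (u \- v))) ->
  (forall n, form_dom q (u_ n)) -> form_cauchy q u_ ->
  exists l : R, q (u_ n) (u_ n) @[n --> \oo] --> l.
Proof.
move=> q0 qlip Du_ qC; suff : cvgn (fun n => Num.sqrt (q (u_ n) (u_ n))).
  move=> /cvg_ex[l ul]; exists (l ^+ 2).
  by apply: sqr_sqrt_cvg => // n; exact: q0.
apply/cauchy_cvgP/cauchy_exP => e e0.
(* The Cauchy condition bounds energies, the claim their square roots; hence the square of [e]. *)
have [N HN] := qC (e ^+ 2) (exprn_gt0 2 e0).
exists (Num.sqrt (q (u_ N) (u_ N))); exists N => // n /= Nn.
rewrite -ball_normE /=; apply: le_lt_trans (qlip _ _ _ _) _ => //.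
by rewrite -(ger0_norm (ltW e0)) -sqrtr_sqr ltr_sqrt ?exprn_gt0// HN.
Qed.

(** * Square-integrable functions and limits in a closed form *)

Section L2.
Context {R : realType} {E : pmetricType R}.
Variable m : {measure set (borel E) -> \bar R}.
Implicit Types (a : form_on (borel E) R) (u : borel E -> R).

Lemma L2_measurable u : L2 m u -> measurable_fun setT u.
Proof. by rewrite /L2 /= => /sub_Lfun_mfun; rewrite inE. Qed.

Lemma L2_linear k u v : L2 m u -> L2 m v -> L2 m ((k \*o u) \+ v).
Proof.
by have [_ H] := Lfun_submod_closed m (lee1n 2); exact: H.
Qed.

Lemma L2_integrable u v : L2 m u -> L2 m v ->
  m.-integrable setT (EFin \o (fun x => u x * v x)).
Proof. by move=> u2 v2; apply/Lfun1_integrable; exact: Lfun2_mul_Lfun1. Qed.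

Lemma inner_semi_inner : semi_inner (FormOn (L2 m) (inner m)).
Proof.
split => /=.
- move=> u v u2 v2; have -> : u \+ v = (1 \*o u) \+ v.
    by apply/funext => x /=; rewrite mul1r.
  exact: L2_linear.
- move=> k u u2; have -> : k \*o u = (k \*o u) \+ cst 0.
    by apply/funext => x /=; rewrite addr0.
  apply: L2_linear => //.
  by have [H _] := Lfun_submod_closed m (lee1n 2).
- by move=> u v _ _; apply: eq_Rintegral => x _; rewrite mulrC.
- move=> k u v w u2 v2 w2; rewrite /inner /=.
  rewrite -RintegralZl//; last exact: L2_integrable.
  have iu := integrableZl measurableT k (L2_integrable u2 w2).
  rewrite -RintegralD//; last exact: L2_integrable.
  by apply: eq_Rintegral => x _; ring.
- by move=> u _; apply: Rintegral_ge0 => x _; rewrite -expr2 sqr_ge0.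
Qed.

Lemma normL2E u : L2 m u -> normL2 m u = (Num.sqrt (inner m u u))%:E.
Proof.
move=> u2; rewrite /normL2 unlock /=.
have -> : (\int[m]_x `|(u x)%:E| `^ 2 = (inner m u u)%:E)%E.
  rewrite /inner /Rintegral fineK; last first.
    by apply: integrable_fin_num => //; exact: L2_integrable.
  apply: eq_integral => x _; rewrite poweR_EFin; congr EFin.
  by rewrite powR_mulrn// real_normK ?num_real// expr2.
rewrite poweR_EFin powR12_sqrt//.
exact: (si_ge0 inner_semi_inner).
Qed.

Lemma normL2_cvg0 (w_ : nat -> borel E -> R) : (forall n, L2 m (w_ n)) ->
  normL2 m (w_ n) @[n --> \oo] --> 0%E <->
  inner m (w_ n) (w_ n) @[n --> \oo] --> 0.
Proof.
move=> w2; under eq_fun do rewrite normL2E//.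
have w0 n : 0 <= inner m (w_ n) (w_ n) := si_ge0 inner_semi_inner (w2 n).
split=> [/fine_cvg|] /=.
  by move=> /(sqr_sqrt_cvg w0); rewrite expr0n.
by move=> /sqrt_cvg; rewrite sqrtr0 => h; apply: cvg_EFin => //; exact: nearW.
Qed.

Lemma inner_eq0 u : L2 m u -> inner m u u = 0 -> u = cst 0 %[ae m].
Proof.
move=> u2 u0; have := normL2E u2; rewrite u0 sqrtr0 => /Lnorm_eq0_eq0.
have /measurable_EFinP mu := L2_measurable u2.
have two0 : (0 < 2 :> \bar R)%E by rewrite lte_fin.
move=> /(_ mu two0); apply: filterS => x /(_ I) [] /= ux _; exact: ux.
Qed.

(* Qualified because MathComp's sesquilinear forms shadow the name. *)
Lemma symmetric_semi_inner a : Defs.symmetric_form m a -> semi_inner a.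
Proof.
move=> aS; split.
- exact: (sf_domD aS).
- exact: (sf_domZ aS).
- exact: (sf_sym aS).
- exact: (sf_linear aS).
- exact: (sf_ge0 aS).
Qed.

(** The sequence is Cauchy for [E1], so closedness gives it a limit [v]. Uniqueness of limits in
    [L2] forces [v = u] a.e., and the form does not see the change of representative. *)
Lemma closed_form_limit a (u_ : nat -> borel E -> R) u :
  Defs.symmetric_form m a -> closed_form m a ->
  closure_approx m a u u_ -> L2 m u ->
  form_dom a u /\ a (u_ n \- u) (u_ n \- u) @[n --> \oo] --> 0.
Proof.
move=> aS aC [Du_ Cu_ u_u] u2.
have aI := symmetric_semi_inner aS; have iI := inner_semi_inner.
have u_2 n : L2 m (u_ n) := sf_L2 aS (Du_ n).
have d2 n : L2 m (u_ n \- u) := si_domB iI (u_2 n) u2.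
have {}u_u := (normL2_cvg0 d2).1 u_u.
have [v Dv] : exists2 v, form_dom a v &
    E1 m a (u_ n \- v) (u_ n \- v) @[n --> \oo] --> 0.
  apply: aC => // e e0; have e20 : 0 < e / 2 by rewrite divr_gt0.
  have [N HN] := Cu_ _ e20.
  have [M _ HM] : \forall n \near \oo, inner m (u_ n \- u) (u_ n \- u) < e / 8.
    by apply: (cvgr_lt _ u_u); rewrite divr_gt0.
  exists (maxn N M) => i j; rewrite !geq_max => /andP[Ni Mi] /andP[Nj Mj].
  (* Half of [e] goes to the form; the factors 2 of [si_sub_le] turn the two bounds [e / 8] into the
     half for the inner product. *)
  have -> : e = e / 2 + (2 * (e / 8) + 2 * (e / 8)) by field.
  rewrite /E1 ltrD// ?HN//.
  have /le_lt_trans := si_sub_le iI (d2 i) (d2 j).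
  have -> : (u_ i \- u) \- (u_ j \- u) = u_ i \- u_ j.
    by apply/funext => x /=; ring.
  by apply; rewrite ltrD// ltr_pM2l//; exact: HM.
have Dd n : form_dom a (u_ n \- v) by exact: si_domB.
have v2 : L2 m v := sf_L2 aS Dv.
have dv2 n : L2 m (u_ n \- v) := sf_L2 aS (Dd n).
move=> E0.
have a0 : a (u_ n \- v) (u_ n \- v) @[n --> \oo] --> 0.
  apply: le_norm_cvg E0 => n; rewrite subr0 ger0_norm; last exact: si_ge0.
  by rewrite lerDl; exact: (si_ge0 iI (dv2 n)).
have i0 : inner m (u_ n \- v) (u_ n \- v) @[n --> \oo] --> 0.
  apply: le_norm_cvg E0 => n.
  rewrite subr0 ger0_norm; last exact: (si_ge0 iI (dv2 n)).
  by rewrite lerDr si_ge0.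
have uv : v = u %[ae m].
  have duv : L2 m (v \- u) := si_domB iI v2 u2.
  have /(inner_eq0 duv) : inner m (v \- u) (v \- u) = 0.
    apply/eqP; rewrite eq_le (si_ge0 iI duv) andbT.
    (* [v \- u] is the difference of two sequences tending to 0 in [L2], so its constant squared
       norm is at most 0. *)
    apply: (cvgr_to_ge (si_sub_cvg0 iI d2 dv2 u_u i0)); apply: nearW => n /=.
    suff -> : (u_ n \- u) \- (u_ n \- v) = v \- u by [].
    by apply/funext => x /=; ring.
  by apply: filterS => x /(_ I) /= /subr0_eq ? _.
have Du : form_dom a u := sf_dom_ae aS Dv u2 uv.
split => //.
suff -> : (fun n => a (u_ n \- u) (u_ n \- u)) =
  fun n => a (u_ n \- v) (u_ n \- v) by [].
apply/funext => n; have Dn : form_dom a (u_ n \- u) by exact: si_domB.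
have ae : u_ n \- u = u_ n \- v %[ae m].
  by apply: filterS uv => x /[apply] /= ->.
(* [sf_val_ae] exchanges the first argument only; symmetry brings the second one there. *)
rewrite (sf_val_ae aS Dn (Dd n) Dn ae) (sf_sym aS)//.
exact: (sf_val_ae aS Dn (Dd n) (Dd n) ae).
Qed.

End L2.

(** * Continuous functions with compact support *)

Section C0.
Context {R : realType} {E : pmetricType R}.
Implicit Types (k : R) (u v : borel E -> R).

Lemma C0_linear k u v : C0 u -> C0 v -> C0 ((k \*o u) \+ v).
Proof.
move=> [uc uK] [vc vK]; split.
  move=> x; apply: cvgD; last exact: vc.
  by apply: cvgM; [exact: cvg_cst|exact: uc].
apply: (subclosed_compact (@closed_closure E _) (compactU uK vK)).
rewrite -closureU; apply: closure_subset => x /= w0.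
apply: contrapT => /not_orP[/negP/negPn/eqP ux /negP/negPn/eqP vx].
by move: w0; rewrite ux vx mulr0 addr0 eqxx.
Qed.

Lemma C0_add u v : C0 u -> C0 v -> C0 (u \+ v).
Proof.
move=> uC vC; have -> : u \+ v = (1 \*o u) \+ v.
  by apply/funext => x /=; rewrite mul1r.
exact: C0_linear.
Qed.

Lemma C0_scale k u : C0 u -> C0 (k \*o u).
Proof.
move=> uC; have -> : k \*o u = ((k - 1) \*o u) \+ u.
  by apply/funext => x /=; ring.
exact: C0_linear.
Qed.

Lemma continuous_borel_measurable (u : borel E -> R) :
  continuous (u : E -> R) -> measurable_fun setT u.
Proof.
move=> uc; apply: (measurability (@RGenOInfty.G R)).
  exact: RGenOInfty.measurableE.
move=> _ [_ [x ->] <-]; rewrite setTI.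
apply: sub_sigma_algebra => /=; move/continuousP : uc; apply; exact: rray_open.
Qed.

(** The product vanishes off the compact support of [u], where it is bounded and the Radon measure
    is finite. *)
Lemma C0_integrable_mul (mu : {measure set (borel E) -> \bar R}) u v :
  radon mu -> C0 u -> C0 v ->
  mu.-integrable setT (EFin \o (fun x => u x * v x)).
Proof.
move=> mur [uc uK] [vc _].
have wc : continuous ((fun x => u x * v x) : E -> R).
  by move=> x; apply: cvgM; [exact: uc|exact: vc].
set K := closure _ in uK.
have mK : measurable (K : set (borel E)).
  rewrite -[K]setCK; apply: measurableC; apply: sub_sigma_algebra.
  exact/closed_openC/closed_closure.
have -> : EFin \o (fun x => u x * v x) = (EFin \o (fun x => u x * v x)) \_ K.
  apply/funext => x; rewrite patchE; case: ifPn => // /negP xK /=.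
  suff -> : u x = 0 by rewrite mul0r.
  apply: contrapT => /eqP ux; apply: xK; rewrite inE; exact: subset_closure.
apply/(integrable_mkcond _ mK); apply: measurable_bounded_integrable => //.
- exact: mur.
- by apply: measurable_funTS; exact: continuous_borel_measurable.
- have /compact_bounded : compact ((fun x => u x * v x : R) @` K).
    by apply: continuous_compact => //; exact: continuous_subspaceT.
  move=> [M [Mr HM]]; exists M; split => // N MN x Kx.
  by apply: (HM N MN); exists x.
Qed.

End C0.

(** * The Schrödinger form and its closure *)

Section Schrodinger.
Context {R : realType} {E : pmetricType R}.
Variables (m mu : {measure set (borel E) -> \bar R}) (a : form_on (borel E) R).
Hypotheses (a_sym : Defs.symmetric_form m a) (a_closed : closed_form m a).
Hypothesis mu_radon : radon mu.
Variable k : R.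
Hypotheses (k_gt1 : 1 < k) (k_lambda : (k%:E <= lambda a mu)%E).
Implicit Types u v w : borel E -> R.

Local Notation s := (schrodinger_form a mu).
Local Notation c := (form_closure m s).
Local Notation aI := (symmetric_semi_inner a_sym).

(** If the integral is positive, dividing [u] by its square root yields a competitor in the infimum
    [lambda]; if it is zero, the claim is nonnegativity of [a]. *)
Lemma integral_sqr_le_form u : form_dom s u ->
  k * (\int[mu]_x (u x * u x)) <= a u u.
Proof.
move=> [Du uC]; set I := \int[mu]_x (u x * u x).
have I0 : 0 <= I by apply: Rintegral_ge0 => x _; rewrite -expr2 sqr_ge0.
have [I00|I_neq0] := eqVneq I 0; first by rewrite I00 mulr0 (si_ge0 aI).
have {I_neq0} Igt0 : 0 < I by rewrite lt_neqAle eq_sym I_neq0.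
pose r := (Num.sqrt I)^-1.
have r2 : r ^+ 2 = I^-1 by rewrite /r exprVn sqr_sqrtr.
have : (k%:E <= (a (r \*o u) (r \*o u))%:E)%E.
  apply: (le_trans k_lambda); apply: ereal_inf_lbound.
  exists (r \*o u) => //; split.
    by split; [exact: (sf_domZ a_sym)|exact: C0_scale].
  have Iu := C0_integrable_mul mu_radon uC uC.
  transitivity ((r ^+ 2)%:E * \int[mu]_x (u x * u x)%:E)%E.
    rewrite -integralZl//; apply: eq_integral => x _ /=.
    by rewrite -EFinM; congr EFin; ring.
  have -> : (\int[mu]_x (u x * u x)%:E = I%:E)%E.
    by rewrite /I /Rintegral fineK//; exact: integrable_fin_num.
  by rewrite -EFinM r2 mulVf// gt_eqF.
by rewrite lee_fin (si_scale aI)// r2 mulrC ler_pdivlMr.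
Qed.

Lemma schrodinger_le u : form_dom s u -> s u u <= a u u.
Proof.
move=> Du; rewrite /= lerBlDr lerDl.
by apply: Rintegral_ge0 => x _; rewrite -expr2 sqr_ge0.
Qed.

Definition theta := 1 - k^-1.

Lemma theta_gt0 : 0 < theta.
Proof. by rewrite subr_gt0 invf_lt1// (lt_trans ltr01). Qed.

Lemma schrodinger_ge u : form_dom s u -> theta * a u u <= s u u.
Proof.
move=> Du; have k0 : 0 < k by exact: lt_trans k_gt1.
have := integral_sqr_le_form Du; rewrite -ler_pdivlMl// /theta /=.
by move=> h; rewrite mulrBl mul1r lerD2l lerN2.
Qed.

Lemma schrodinger_semi_inner : semi_inner s.
Proof.
split.
- by move=> u v [Du uC] [Dv vC]; split; [exact: (si_domD aI)|exact: C0_add].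
- by move=> r u [Du uC]; split; [exact: (si_domZ aI)|exact: C0_scale].
- move=> u v [Du uC] [Dv vC] /=; rewrite (si_sym aI)//; congr (_ - _).
  by apply: eq_Rintegral => x _; rewrite mulrC.
- move=> r u v w [Du uC] [Dv vC] [Dw wC] /=; rewrite (si_linear aI)//.
  have -> : \int[mu]_x ((r * u x + v x) * w x) =
      r * \int[mu]_x (u x * w x) + \int[mu]_x (v x * w x).
    have iu := C0_integrable_mul mu_radon uC wC.
    have iv := C0_integrable_mul mu_radon vC wC.
    have riu := integrableZl measurableT r iu.
    rewrite -RintegralZl// -RintegralD//.
    by apply: eq_Rintegral => x _; ring.
  by ring.
- move=> u Du; apply: le_trans (schrodinger_ge Du).
  by rewrite mulr_ge0 ?(ltW theta_gt0)// (si_ge0 aI)//; case: Du.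
Qed.
Local Notation sI := schrodinger_semi_inner.

(** By [schrodinger_ge] a Cauchy sequence for [s] is Cauchy for [a], at the price of the factor
    [theta]; closedness of [a] does the rest. *)
Lemma schrodinger_limit (u_ : nat -> borel E -> R) u :
  closure_approx m s u u_ -> L2 m u ->
  form_dom a u /\ a (u_ n \- u) (u_ n \- u) @[n --> \oo] --> 0.
Proof.
move=> [Du_ Cu_ u_u] u2; apply: (closed_form_limit a_sym a_closed) => //.
split => // [n|e e0]; first by have [] := Du_ n.
have [N HN] := Cu_ (theta * e) (mulr_gt0 theta_gt0 e0).
exists N => i j Ni Nj; rewrite -(ltr_pM2l theta_gt0).
apply: le_lt_trans (HN i j Ni Nj); apply: schrodinger_ge.
exact: (si_domB sI).
Qed.

(** This is closability. The limit [u] may lie outside the core, so both sequences are compared with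
    it in [a]; [schrodinger_le] then brings their difference back to [s]. *)
Lemma closure_approx_diff (u_ v_ : nat -> borel E -> R) u : L2 m u ->
  closure_approx m s u u_ -> closure_approx m s u v_ ->
  s (v_ n \- u_ n) (v_ n \- u_ n) @[n --> \oo] --> 0.
Proof.
move=> u2 ua va; have [Du uu] := schrodinger_limit ua u2.
have [_ vu] := schrodinger_limit va u2; move: ua va => [Du_ _ _] [Dv_ _ _].
have Dau n : form_dom a (u_ n) := (Du_ n).1.
have Dav n : form_dom a (v_ n) := (Dv_ n).1.
have Ddu n : form_dom a (u_ n \- u) by exact: (si_domB aI).
have Ddv n : form_dom a (v_ n \- u) by exact: (si_domB aI).
apply: le_norm_cvg (si_sub_cvg0 aI Ddv Ddu vu uu) => n.
have Dd := si_domB sI (Dv_ n) (Du_ n).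
rewrite subr0 ger0_norm; last exact: (si_ge0 sI).
have -> : (v_ n \- u) \- (u_ n \- u) = v_ n \- u_ n.
  by apply/funext => x /=; ring.
exact: schrodinger_le.
Qed.

(** Completeness gives a limit along [u_]. The value selected by [xget] comes from other sequences,
    which differ from [u_] by vanishing energy and so have the same limit. *)
Lemma closure_approx_cvg (u_ : nat -> borel E -> R) u : L2 m u ->
  closure_approx m s u u_ -> s (u_ n) (u_ n) @[n --> \oo] --> c u u.
Proof.
move=> u2 ua; have [Du_ Cu_ _] := ua.
have [l ul] := lipschitz_cauchy_cvg (si_ge0 sI) (si_lipschitz sI) Du_ Cu_.
suff -> : c u u = l by [].
(* [form_closure] lets the two arguments, even when equal, be approximated by
   different sequences. *)
rewrite /=; case: xgetP => [l' -> [v_ [w_ [va wa vwl']]]|/(_ l)[]]; last first.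
  by exists u_, u_.
have Dv_ : forall n, form_dom s (v_ n) by have [] := va.
have Dw_ : forall n, form_dom s (w_ n) by have [] := wa.
have vl := si_cvg sI Du_ Dv_ (closure_approx_diff u2 ua va) ul.
have := si_cross_cvg sI Dv_ Dw_ (closure_approx_diff u2 va wa) vl.
exact: cvg_unique vwl'.
Qed.

Lemma closure_approxB (u_ v_ : nat -> borel E -> R) u v : L2 m u -> L2 m v ->
  closure_approx m s u u_ -> closure_approx m s v v_ ->
  closure_approx m s (u \- v) (fun n => u_ n \- v_ n).
Proof.
move=> u2 v2 [Du_ Cu_ uu] [Dv_ Cv_ vv]; split.
- by move=> n; exact: (si_domB sI).
(* [si_sub_le] doubles each of the two energies. *)
- move=> e e0; have e40 : 0 < e / 4 by rewrite divr_gt0.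
  have [N HN] := Cu_ _ e40; have [M HM] := Cv_ _ e40.
  exists (maxn N M) => i j; rewrite !geq_max => /andP[Ni Mi] /andP[Nj Mj].
  have -> : (u_ i \- v_ i) \- (u_ j \- v_ j) = (u_ i \- u_ j) \- (v_ i \- v_ j).
    by apply/funext => x /=; ring.
  have Du := si_domB sI (Du_ i) (Du_ j); have Dv := si_domB sI (Dv_ i) (Dv_ j).
  apply: le_lt_trans (si_sub_le sI Du Dv) _.
  by have := HN i j Ni Nj; have := HM i j Mi Mj; lra.
- have iI := inner_semi_inner m.
  have u_2 n : L2 m (u_ n) := sf_L2 a_sym (Du_ n).1.
  have v_2 n : L2 m (v_ n) := sf_L2 a_sym (Dv_ n).1.
  have du n : L2 m (u_ n \- u) := si_domB iI (u_2 n) u2.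
  have dv n : L2 m (v_ n \- v) := si_domB iI (v_2 n) v2.
  have dE n : (u_ n \- v_ n) \- (u \- v) = (u_ n \- u) \- (v_ n \- v).
    by apply/funext => x /=; ring.
  under eq_fun do rewrite dE.
  have dd n : L2 m ((u_ n \- u) \- (v_ n \- v)) := si_domB iI (du n) (dv n).
  apply/(normL2_cvg0 dd).
  by apply: (si_sub_cvg0 iI du dv); exact/normL2_cvg0.
Qed.

Lemma closure_ge u : form_dom c u -> form_dom a u /\ theta * a u u <= c u u.
Proof.
move=> [u2 [u_ ua]]; have [Du uu] := schrodinger_limit ua u2; split => //.
have [Du_ _ _] := ua; have Dau n : form_dom a (u_ n) := (Du_ n).1.
have au : a (u_ n) (u_ n) @[n --> \oo] --> a u u.
  (* The constant sequence [u] is the one of known energy limit. *)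
  apply: (si_cvg aI (fun=> Du) Dau uu); exact: cvg_cst.
apply: (ler_cvg_to (cvgM (cvg_cst theta) au) (closure_approx_cvg u2 ua)).
by apply: nearW => n; exact: schrodinger_ge.
Qed.

Lemma closure_ge0 u : form_dom c u -> 0 <= c u u.
Proof.
move=> /closure_ge[Du]; apply: le_trans.
by rewrite mulr_ge0 ?(ltW theta_gt0)// (si_ge0 aI).
Qed.

(** The bound for [s] passes to the limit along approximating sequences, which bypasses bilinearity
    of the closure. *)
Lemma closure_lipschitz u v : form_dom c u -> form_dom c v ->
  `|Num.sqrt (c u u) - Num.sqrt (c v v)| <= Num.sqrt (c (u \- v) (u \- v)).
Proof.
move=> [u2 [u_ ua]] [v2 [v_ va]].
have uv2 : L2 m (u \- v) := si_domB (inner_semi_inner m) u2 v2.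
have cu := sqrt_cvg (closure_approx_cvg u2 ua).
have cv := sqrt_cvg (closure_approx_cvg v2 va).
have cuv := sqrt_cvg (closure_approx_cvg uv2 (closure_approxB u2 v2 ua va)).
apply: (ler_cvg_to (cvg_norm (cvgB cu cv)) cuv).
apply: nearW => n; have [Du_ _ _] := ua; have [Dv_ _ _] := va.
exact: (si_lipschitz sI (Du_ n) (Dv_ n)).
Qed.

(** This ensures that [ext_energy] of the closure is a genuine limit and not the default 0 of
    [xget]. *)
Lemma closure_energy_cvg (u_ : nat -> borel E -> R) :
  (forall n, form_dom c (u_ n)) -> form_cauchy c u_ ->
  exists l : R, c (u_ n) (u_ n) @[n --> \oo] --> l.
Proof. exact: (lipschitz_cauchy_cvg closure_ge0 closure_lipschitz). Qed.

End Schrodinger.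

(** * Weighted integrals and Fatou's lemma *)

Section Weighted.
Context d (T : measurableType d) (R : realType).
Variable m : {measure set T -> \bar R}.

(** The integrand agrees a.e. with the lower limit of the [|u_ n| g], so Fatou's lemma bounds its
    integral by the lower limit of the integrals, hence by the limit of [b_]. *)
Lemma fatou_weighted (g : T -> R) (u_ : nat -> T -> R) (u : T -> \bar R)
    (b_ : nat -> R) (b : R) :
  measurable_fun setT g -> (forall x, 0 <= g x) ->
  (forall n, measurable_fun setT (u_ n)) -> measurable_fun setT u ->
  {ae m, forall x, (u_ n x)%:E @[n --> \oo] --> u x} ->
  (forall n, (\int[m]_x (`|u_ n x| * g x)%:E <= (b_ n)%:E)%E) ->
  b_ n @[n --> \oo] --> b ->
  (\int[m]_x (`|u x| * (g x)%:E) <= b%:E)%E.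
Proof.
move=> mg g0 mu_ mu uu ub bb.
pose f n x := (`|u_ n x| * g x)%:E.
have mf n : measurable_fun setT (f n).
  apply/measurable_EFinP; apply: measurable_funM => //.
  exact: measurableT_comp.
have f0 n x : (0 <= f n x)%E by rewrite lee_fin mulr_ge0.
have fu : ae_eq m setT (fun x => `|u x| * (g x)%:E)%E
    (fun x => limn_einf (f^~ x)).
  apply: filterS uu => x ux _; apply/esym.
  have : f n x @[n --> \oo] --> (`|u x| * (g x)%:E)%E.
    have -> : f^~ x = (fun n => `|(u_ n x)%:E| * (g x)%:E)%E by [].
    by apply: cvgeZr => //; exact: cvg_abse.
  by move=> /cvg_limn_einf_sup[].
rewrite (ge0_ae_eq_integral _ _ _ _ _ fu)//.
- apply: (le_trans (fatou m measurableT mf (fun n x _ => f0 n x))).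
  have bE : (b_ n)%:E @[n --> \oo] --> b%:E.
    by apply: cvg_EFin => //; exact: nearW.
  rewrite limn_einf_lim -(cvg_lim _ bE)//.
  apply: lee_lim; [exact: is_cvg_einfs|by apply/cvg_ex; exists b%:E|].
  apply: nearW => n; apply: le_trans (ub n).
  (* The infimum of the tail starting at [n] is below its first term. *)
  by apply: ereal_inf_lbound; exists n => /=.
- apply: emeasurable_funM; last exact/measurable_EFinP.
  exact: measurableT_comp.
- apply: measurableT_comp => //; apply: measurable_fun_limn_esup => n.
  exact: measurableT_comp.
- by move=> x _; rewrite mule_ge0 ?lee_fin.
- move=> x _; rewrite limn_einf_lim; apply: lime_ge; first exact: is_cvg_einfs.
  by apply: nearW => n; apply: le_ereal_inf_tmp => _ [i _ <-].
Qed.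

(** The absolute value alters [g] on a null set only, and makes the weight nonnegative everywhere,
    as [fatou_weighted] asks. *)
Lemma integral_weight_scale (g u : T -> R) r :
  measurable_fun setT g -> measurable_fun setT u -> {ae m, forall x, 0 < g x} ->
  0 <= r ->
  (\int[m]_x (`|u x| * (r * `|g x|))%:E = r%:E * \int[m]_x (`|u x| * g x)%:E)%E.
Proof.
move=> mg mu g0 r0.
have mug : measurable_fun setT (fun x => (`|u x| * g x)%:E).
  apply/measurable_EFinP; apply: measurable_funM => //.
  exact: measurableT_comp.
have mugn : measurable_fun setT (fun x => (`|u x| * `|g x|)%:E).
  by apply/measurable_EFinP; apply: measurable_funM; exact: measurableT_comp.
rewrite [in RHS](ae_eq_integral (fun x => (`|u x| * `|g x|)%:E) _)//.
  rewrite -ge0_integralZl//.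
  by apply: eq_integral => x _; rewrite -EFinM mulrCA.
by apply: filterS g0 => x gx _; rewrite (gtr0_norm gx).
Qed.

End Weighted.

(** * Reference functions and subcriticality *)

Lemma reference_function_scale {R : realType} {E : pmetricType R}
    (m : {measure set (borel E) -> \bar R}) (g : borel E -> R) (r : R) :
  0 < r -> reference_function m g -> reference_function m (fun x => r * `|g x|).
Proof.
move=> r0 [gb g1 g0]; split.
- move: gb => [M [Mr HM]]; exists (r * Num.max M 0); split.
    exact: num_real.
  move=> N MN x _ /=; rewrite normrM normr_id gtr0_norm// mulrC -ler_pdivlMr//.
  apply: HM => //; rewrite ltr_pdivlMr// mulrC; apply: le_lt_trans MN.
  by rewrite ler_pM2l// le_max lexx.
- have -> : (fun x => r * `|g x|) = r \o* (Num.norm \o g).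
    by apply/funext => x /=; rewrite mulrC.
  exact: (Lfun_scale r (lexx 1) (Lfun_norm g1)).
- by apply: filterS g0 => x gx; rewrite mulr_gt0// normr_gt0 gt_eqF.
Qed.

Theorem theorem3p7 (R : realType) (E : pmetricType R)
  (E_locally_compact : locally_compact [set: E])
  (E_separable : @separable_space R E)
  (m : {measure set (borel E) -> \bar R})
  (m_radon : radon m) (m_support : full_support m)
  (a : form_on (borel E) R)
  (a_dirichlet : dirichlet_form m a)
  (a_regular : regular_form m a)
  (a_irreducible : irreducible_form m a)
  (a_transient : transient m a)
  (compact_L : forall K : set E, compact K -> class_L m a (\1_K : borel E -> R))
  (mu : {measure set (borel E) -> \bar R})
  (mu_radon : radon mu) (mu_smooth : smooth m a mu)
  (mu_lambda : (1 < lambda a mu)%E) :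
  subcritical m (form_closure m (schrodinger_form a mu)).
Proof.
have [a_sym a_closed _] := a_dirichlet.
have [k k_gt1 k_lambda] : exists2 k : R, 1 < k & (k%:E <= lambda a mu)%E.
  (* A finite [lambda] is itself the constant; if it is [+oo], as happens when no test function is
     normalised, 2 is taken. *)
  move: mu_lambda; case: (lambda a mu) => [k k1| _|//]; first by exists k.
  by exists 2; rewrite ?leey// ltr1n.
have [g gref ag] := a_transient; have [_ g1 g0] := gref.
have mg : measurable_fun setT g by move: (sub_Lfun_mfun g1); rewrite inE.
(* The square root appears because transience bounds integrals by square roots of energies. *)
set c := form_closure m _; pose r := Num.sqrt (theta k).
have r0 : 0 < r by rewrite sqrtr_gt0 theta_gt0.
have cge u : form_dom c u -> form_dom a u /\ theta k * a u u <= c u u.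
  exact: closure_ge.
have mc u : form_dom c u -> measurable_fun setT u.
  by move=> [u2 _]; exact: L2_measurable u2.
have c_bound u : form_dom c u ->
    (\int[m]_x (`|u x| * (r * `|g x|))%:E <= (Num.sqrt (c u u))%:E)%E.
  move=> Du; have [Dau auc] := cge _ Du.
  rewrite integral_weight_scale ?(ltW r0)//; last exact: mc.
  apply: (@le_trans _ _ (r%:E * (Num.sqrt (a u u))%:E)%E).
    by rewrite lee_pmul2l ?lte_fin//; exact: ag.
  by rewrite -EFinM lee_fin -sqrtrM ?ler_wsqrtr// ltW// theta_gt0.
exists (fun x => r * `|g x|); first exact: reference_function_scale.
move=> u [mu_u _ [u_ uu]]; rewrite /ext_energy.
(* Fatou's lemma is applied along the sequence [v_] that realises the selected energy [l], which may
   differ from [u_]. *)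
case: xgetP => [l -> [v_ [Dv_ _ vu] vl]|noenergy].
  have v_bound n := c_bound _ (Dv_ n).
  apply: (fatou_weighted _ _ _ mu_u vu v_bound (sqrt_cvg vl)).
  - by apply: measurable_funM => //; exact: measurableT_comp.
  - by move=> x; rewrite mulr_ge0 ?(ltW r0).
  - by move=> n; exact: mc.
(* The default branch of [xget] is impossible: the energies along [u_] converge. *)
have [Du_ Cu_ _] := uu.
have [l ul] : exists l : R, c (u_ n) (u_ n) @[n --> \oo] --> l.
  exact: (closure_energy_cvg a_sym a_closed mu_radon k_gt1 k_lambda).
by case: (noenergy l); exists u_.
Qed.
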